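(* Let $\mathcal{T}\in\mathbb{R}^{I\times J\times I\times J}$ and $R=\mathrm{rank}(f(\mathcal{T}))$, where $f$ is the matricization map. The tensor singular value decomposition $$\mathcal{T}=\mathcal{U}\ast_2\mathcal{S}\ast_2\mathcal{V}^T,$$ where $\mathcal{U},\mathcal{V}\in\mathbb{R}^{I\times J\times I\times J}$ are orthogonal tensors and $\mathcal{S}\in\mathbb{R}^{I\times J\times I\times J}$ is a diagonal tensor with entries $\sigma_{klkl}$ (the singular values), is equivalent to the canonical polyadic (CP) decomposition $$\mathcal{T}=\sum_{r=1}^{R}a_r\circ b_r\circ c_r\circ d_r$$ if there exist $\mathcal{A}\in\mathbb{R}^{I\times I\times J}$, $\mathcal{B}\in\mathbb{R}^{J\times I\times J}$, $\mathcal{C}\in\mathbb{R}^{I\times I\times J}$ and $\mathcal{D}\in\mathbb{R}^{J\times I\times J}$ such that $a_{ikl}b_{jkl}=u_{ijkl}$ and $c_{\hat ikl}d_{\hat jkl}=v_{\hat i\hat jkl}$.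
   Context: For $\mathcal{X},\mathcal{Y}\in\mathbb{R}^{I\times J\times I\times J}$: the Einstein product is $(\mathcal{X}\ast_2\mathcal{Y})_{ij\hat i\hat j}=\sum_{u=1}^{I}\sum_{v=1}^{J}x_{ijuv}y_{uv\hat i\hat j}$; the transpose is $(\mathcal{X}^T)_{ijkl}=x_{klij}$; $\mathcal{X}$ is orthogonal if $\mathcal{X}^T\ast_2\mathcal{X}=\mathcal{I}$, where $\mathcal{I}$ has entries $(\mathcal{I})_{ijkl}=\delta_{ik}\delta_{jl}$; $\mathcal{X}$ is diagonal if $x_{ijkl}=0$ unless $i=k$ and $j=l$. Lower-case letters with indices denote the entries of the corresponding tensors. The matricization $f(\mathcal{X})\in\mathbb{R}^{IJ\times IJ}$ is $(f(\mathcal{X}))_{[i+(j-1)I],[k+(l-1)I]}=x_{ijkl}$. A CP decomposition of a fourth order tensor in $\mathbb{R}^{I\times J\times I\times J}$ is a linear combination of rank-one tensors, written $\sum_{r=1}^{R}a_r\circ b_r\circ c_r\circ d_r$ with $a_r,c_r\in\mathbb{R}^I$ and $b_r,d_r\in\mathbb{R}^J$, where $(a\circ b\circ c\circ d)_{ijkl}=a_ib_jc_kd_l$. *)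

(* Defs.v *)
From mathcomp Require Import all_boot all_order all_algebra.
From mathcomp Require Import reals.

Set Implicit Arguments.
Unset Strict Implicit.
Unset Printing Implicit Defensive.

Import GRing.Theory.
Local Open Scope ring_scope.

(* The space R^{I x J x I x J}; the entry x_{ijkl} is X (i, j, k, l). *)
Definition tensor4 (R : realType) (I J : nat) :=
  {ffun 'I_I * 'I_J * 'I_I * 'I_J -> R}.

(* The space R^{m x n x p}; the entry a_{ikl} is A (i, k, l). *)
Definition tensor3 (R : realType) (m n p : nat) :=
  {ffun 'I_m * 'I_n * 'I_p -> R}.

Section Tensors.
Variables (R : realType) (I J : nat).
Implicit Types (X Y : tensor4 R I J).

Definition einstein X Y : tensor4 R I J :=
  [ffun t => let: (i, j, k, l) := t in
     \sum_(u < I) \sum_(v < J) X (i, j, u, v) * Y (u, v, k, l)].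

Definition ttranspose X : tensor4 R I J :=
  [ffun t => let: (i, j, k, l) := t in X (k, l, i, j)].

Definition tid : tensor4 R I J :=
  [ffun t => let: (i, j, k, l) := t in (i == k)%:R * (j == l)%:R].

Definition torthogonal X : Prop := einstein (ttranspose X) X = tid.

Definition tdiagonal X : Prop :=
  forall i j k l, ~ (i = k /\ j = l) -> X (i, j, k, l) = 0.

(* In 0-based indexing the column-major index [i + (j-1)I] is i + j * I. *)
Lemma vidx_proof (i : 'I_I) (j : 'I_J) : (i + j * I < I * J)%N.
Proof.
apply: (@leq_trans (j.+1 * I)); first by rewrite mulSn ltn_add2r.
by rewrite [X in (_ <= X)%N]mulnC leq_mul2r ltn_ord orbT.
Qed.

Definition vidx (i : 'I_I) (j : 'I_J) : 'I_(I * J) := Ordinal (vidx_proof i j).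

Lemma vrow_proof (p : 'I_(I * J)) : (p %% I < I)%N.
Proof. by rewrite ltn_mod; case: (posnP I) p => // -> []. Qed.

Lemma vcol_proof (p : 'I_(I * J)) : (p %/ I < J)%N.
Proof.
have I_gt0 : (0 < I)%N by case: (posnP I) p => // -> [].
by rewrite ltn_divLR // [X in (_ < X)%N]mulnC ltn_ord.
Qed.

Definition vrow (p : 'I_(I * J)) : 'I_I := Ordinal (vrow_proof p).
Definition vcol (p : 'I_(I * J)) : 'I_J := Ordinal (vcol_proof p).

Definition matricization X : 'M[R]_(I * J) :=
  \matrix_(p, q) X (vrow p, vcol p, vrow q, vcol q).

Lemma vidxK i j : (vrow (vidx i j), vcol (vidx i j)) = (i, j).
Proof.
have I_gt0 : (0 < I)%N by case: (posnP I) i => // -> [].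
congr pair; apply: val_inj => /=.
  by rewrite addnC modnMDl modn_small.
by rewrite addnC divnMDl // divn_small // addn0.
Qed.

Lemma matricizationE X i j k l :
  matricization X (vidx i j) (vidx k l) = X (i, j, k, l).
Proof.
by rewrite mxE; case: (vidxK i j) (vidxK k l) => -> -> [-> ->].
Qed.

Definition rank_one (a : 'cV[R]_I) (b : 'cV[R]_J) (c : 'cV[R]_I) (d : 'cV[R]_J)
    : tensor4 R I J :=
  [ffun t => let: (i, j, k, l) := t in a i 0 * b j 0 * c k 0 * d l 0].

Definition cp_sum (n : nat) (a : 'I_n -> 'cV[R]_I) (b : 'I_n -> 'cV[R]_J)
    (c : 'I_n -> 'cV[R]_I) (d : 'I_n -> 'cV[R]_J) : tensor4 R I J :=
  \sum_(r < n) rank_one (a r) (b r) (c r) (d r).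

Definition singular_value (S : tensor4 R I J) (kl : 'I_I * 'I_J) : R :=
  S (kl.1, kl.2, kl.1, kl.2).

(* The mode-1 fiber A_{:kl}. *)
Definition fiber (m : nat) (A : tensor3 R m I J) (kl : 'I_I * 'I_J)
    : 'cV[R]_m :=
  \col_i A (i, kl.1, kl.2).

End Tensors.

(* Main.v *)
Require Import Defs.
From mathcomp Require Import all_boot all_order all_algebra.
From mathcomp Require Import reals.

Set Implicit Arguments.
Unset Strict Implicit.
Unset Printing Implicit Defensive.

Import GRing.Theory.
Local Open Scope ring_scope.

(** The CP sum on the right is the SVD product with its zero terms deleted, so
    the equivalence amounts to the number of nonzero singular values being
    [\rank (matricization T)]: keeping only the corresponding columns of the
    matricizations of [U] and [V] writes that of [T] as [P *m D *m Q^T] with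
    [P], [Q] having orthonormal columns and [D] an invertible diagonal. *)

(** The inner dimension bounds the rank by [n]. Conversely, multiplying by [P^T] on the left and [Q]
    on the right recovers [diag_mx d], which is invertible, and products never raise the rank. *)
Lemma mxrank_orthonormal_diag (F : fieldType) (m n p : nat) (P : 'M[F]_(m, n))
    (d : 'rV[F]_n) (Q : 'M[F]_(p, n)) :
  P^T *m P = 1%:M -> Q^T *m Q = 1%:M -> (forall r, d 0 r != 0) ->
  \rank (P *m diag_mx d *m Q^T) = n.
Proof.
move=> orthP orthQ d_neq0; set M := P *m _ *m _.
have rank_d : \rank (diag_mx d) = n.
  apply: mxrank_unit; rewrite unitmxE det_diag unitfE.
  by apply/prodf_neq0 => r _; exact: d_neq0.
have diagE : P^T *m M *m Q = diag_mx d.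
  by rewrite /M !mulmxA orthP mul1mx -mulmxA orthQ mulmx1.
apply/eqP; rewrite eqn_leq; apply/andP; split.
  by rewrite /M -mulmxA; apply: leq_trans (mxrankM_maxl _ _) (rank_leq_col _).
rewrite -[X in (X <= _)%N]rank_d -diagE.
exact: leq_trans (mxrankM_maxl _ _) (mxrankM_maxr _ _).
Qed.

Lemma vrowcolK (I J : nat) (p : 'I_(I * J)) : vidx (vrow p) (vcol p) = p.
Proof. by apply: val_inj; rewrite /= addnC -divn_eq. Qed.

Lemma sum_vrowcol (M : nmodType) (I J : nat) (F : 'I_I * 'I_J -> M) :
  \sum_(p < I * J) F (vrow p, vcol p) = \sum_kl F kl.
Proof.
rewrite [RHS](reindex (fun p : 'I_(I * J) => (vrow p, vcol p))) //.
exists (fun kl => vidx kl.1 kl.2) => [p _ | [k l] _] /=.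
  exact: vrowcolK.
exact: vidxK.
Qed.

Section TensorSVD.
Variables (R : realType) (I J : nat).
Implicit Types (T U S V : tensor4 R I J).

(** Diagonality of [S] collapses the inner double sum to one term; the terms with a zero singular
    value then drop out. *)
Lemma einstein_svdE U S V i j k l : tdiagonal S ->
  einstein (einstein U S) (ttranspose V) (i, j, k, l) =
    \sum_(kl | singular_value S kl != 0)
      U (i, j, kl.1, kl.2) * singular_value S kl * V (k, l, kl.1, kl.2).
Proof.
move=> diagS; rewrite ffunE pair_bigA /= [RHS]big_mkcond /=.
apply: eq_bigr => -[u v] _; rewrite !ffunE pair_bigA /=.
rewrite (bigD1 (u, v)) //= big1 ?addr0 => [|[u' v'] /= neq_uv].
  by case: eqP => //= S0; rewrite -/(singular_value S (u, v)) S0 mulr0 mul0r.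
rewrite diagS ?mulr0 // => -[eq_u eq_v].
by rewrite eq_u eq_v eqxx in neq_uv.
Qed.

(** Orthonormality of the columns of [matricization U], still indexed by pairs. *)
Lemma torthogonalE U (kl kl' : 'I_I * 'I_J) : torthogonal U ->
  \sum_uv U (uv.1, uv.2, kl.1, kl.2) * U (uv.1, uv.2, kl'.1, kl'.2) =
    (kl == kl')%:R.
Proof.
case: kl kl' => [k l] [k' l'] /ffunP/(_ (k, l, k', l')).
rewrite !ffunE pair_bigA xpair_eqE -natrM mulnb => <- /=.
by apply: eq_bigr => uv _; rewrite ffunE.
Qed.

(** Column [r] is the column of [matricization U] at [vidx (g r).1 (g r).2]. *)
Definition matricization_cols n U (g : 'I_n -> 'I_I * 'I_J) : 'M[R]_(I * J, n) :=
  \matrix_(p, r) U (vrow p, vcol p, (g r).1, (g r).2).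

Lemma matricization_cols_orthonormal n U (g : 'I_n -> 'I_I * 'I_J) :
  torthogonal U -> injective g ->
  (matricization_cols U g)^T *m matricization_cols U g = 1%:M.
Proof.
move=> orthU g_inj; apply/matrixP => r s; rewrite !mxE -(inj_eq g_inj).
rewrite -(torthogonalE _ _ orthU) -sum_vrowcol.
by apply: eq_bigr => p _; rewrite !mxE.
Qed.

Lemma rank_matricization_svd U S V :
  torthogonal U -> torthogonal V -> tdiagonal S ->
  \rank (matricization (einstein (einstein U S) (ttranspose V))) =
    #|[pred kl | singular_value S kl != 0]|.
Proof.
move=> orthU orthV diagS; set supp := [pred kl | _].
pose g : 'I_#|supp| -> 'I_I * 'I_J := enum_val.
have g_inj : injective g by exact: enum_val_inj.
pose d : 'rV_#|supp| := \row_r singular_value S (g r).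
(* The cardinal is turned into the rank of the thin factorization, so that only an equality of
   matrices remains. *)
rewrite -(@mxrank_orthonormal_diag _ _ _ _ (matricization_cols U g) d
            (matricization_cols V g)) //; first last.
- by move=> r; rewrite mxE; exact: (enum_valP r).
- exact: matricization_cols_orthonormal.
- exact: matricization_cols_orthonormal.
congr (\rank _); apply/matrixP => p q.
rewrite mxE einstein_svdE // mul_mx_diag mxE.
rewrite (eq_bigl [in supp]) // big_enum_val.
by apply: eq_bigr => r _; rewrite !mxE.
Qed.

(** Since [e] is a bijection onto the support of the singular values, this is [einstein_svdE]
    reindexed, with the entries of [U] and [V] factored. Both directions of the theorem rest on
    it. *)
Lemma cp_sum_svd U S V n (e : 'I_n -> 'I_I * 'I_J)
    (A : tensor3 R I I J) (B : tensor3 R J I J)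
    (C : tensor3 R I I J) (D : tensor3 R J I J) :
  tdiagonal S ->
  (forall i j k l, A (i, k, l) * B (j, k, l) = U (i, j, k, l)) ->
  (forall i j k l, C (i, k, l) * D (j, k, l) = V (i, j, k, l)) ->
  injective e ->
  (forall kl, (exists r, e r = kl) <-> singular_value S kl <> 0) ->
  cp_sum (fun r => singular_value S (e r) *: fiber A (e r))
         (fun r => fiber B (e r)) (fun r => fiber C (e r))
         (fun r => fiber D (e r))
    = einstein (einstein U S) (ttranspose V).
Proof.
move=> diagS ABE CDE e_inj e_supp; apply/ffunP => -[[[i j] k] l].
rewrite einstein_svdE // sum_ffunE.
rewrite (eq_bigl [in codom e]) => [|kl]; last first.
  apply/idP/codomP => [/eqP/e_supp[r <-] | [r ->]]; first by exists r.
  by apply/eqP/e_supp; exists r.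
(* Injectivity makes [codom e] duplicate-free, so summing over its members is summing over [r]. *)
rewrite -big_uniq ?big_image; last by apply/injectiveP.
apply: eq_bigr => r _; rewrite !ffunE !mxE -ABE -CDE.
by rewrite [_ * singular_value S _]mulrC !mulrA.
Qed.
End TensorSVD.

Theorem lemma3p16 (R : realType) (I J : nat) (T U S V : tensor4 R I J)
    (rk : nat) (rkE : rk = \rank (matricization T))
    (orthU : torthogonal U) (orthV : torthogonal V) (diagS : tdiagonal S)
    (A : tensor3 R I I J) (B : tensor3 R J I J)
    (C : tensor3 R I I J) (D : tensor3 R J I J)
    (ABE : forall (i : 'I_I) (j : 'I_J) (k : 'I_I) (l : 'I_J),
       A (i, k, l) * B (j, k, l) = U (i, j, k, l))
    (CDE : forall (i : 'I_I) (j : 'I_J) (k : 'I_I) (l : 'I_J),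
       C (i, k, l) * D (j, k, l) = V (i, j, k, l)) :
  T = einstein (einstein U S) (ttranspose V)
  <->
  exists e : 'I_rk -> 'I_I * 'I_J,
    [/\ injective e,
        forall kl : 'I_I * 'I_J,
          (exists r, e r = kl) <-> singular_value S kl <> 0
      & T = cp_sum (fun r => singular_value S (e r) *: fiber A (e r))
                   (fun r => fiber B (e r))
                   (fun r => fiber C (e r))
                   (fun r => fiber D (e r))].
Proof.
split=> [TE | [e [e_inj e_supp ->]]]; last exact: (cp_sum_svd diagS ABE CDE).
pose supp := [pred kl | singular_value S kl != 0].
(* Here the rank enters: it is the size of the support, whose enumeration can thus be indexed by
   ['I_rk] through a cast. *)
have cardE : rk = #|supp| by rewrite rkE TE rank_matricization_svd.
pose e (r : 'I_rk) : 'I_I * 'I_J := enum_val (cast_ord cardE r).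
have e_inj : injective e.
  exact: inj_comp enum_val_inj (@cast_ord_inj _ _ cardE).
have e_supp kl : (exists r, e r = kl) <-> singular_value S kl <> 0.
  split=> [[r <-] | /eqP S_kl].
    by apply/eqP; exact: (enum_valP (cast_ord cardE r)).
  (* [enum_rank_in] needs a witness that the support is inhabited; [kl] itself serves. *)
  have supp_kl : kl \in supp by [].
  exists (cast_ord (esym cardE) (enum_rank_in supp_kl kl)).
  by rewrite /e cast_ordKV enum_rankK_in.
by exists e; split=> //; rewrite (cp_sum_svd diagS ABE CDE).
Qed.
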